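(* Let $n\geq 3$, and let $q_i,p_i$ ($i=1,\dots,n$) be integers with $|p_i|>1$ and $\gcd(q_i,p_i)=1$ for all $i$, such that the Montesinos link $K=K(q_1/p_1,\cdots,q_n/p_n)\subset S^3$ is a knot. Then $K$ is not $SU(2)$-simple.
   Context: **Montesinos links.** For coprime integers $q,p$ with $|p|>1$, the rational tangle $q/p$ is the rational tangle in the $3$-ball (with four marked boundary points NW, NE, SW, SE) of slope $q/p$, in the convention where $0/1$ is the tangle consisting of two horizontal arcs, $1/0$ consists of two vertical arcs, an integer tangle $e/1$ is a horizontal row of $|e|$ half twists, and $1/p$ is a vertical column of $|p|$ half twists. The Montesinos link $K(q_1/p_1,\dots,q_n/p_n)$ is the cyclic tangle sum of the $n$ rational tangles $q_1/p_1,\dots,q_n/p_n$, where $|p_i|>1$ and $\gcd(q_i,p_i)=1$ for all $i$: the tangles are placed side by side in this cyclic order, the two right endpoints of each tangle being joined by two arcs to the two left endpoints of the next, and the last tangle being joined in the same way to the first. (An extra row of $e$ horizontal half twists may be absorbed into one of the tangles.) When all $q_i=1$ this is the pretzel link with parameters $p_1,\dots,p_n$. It is called a Montesinos knot if it has one component. **$SU(2)$-simple knots.** For a knot $K$ in $S^3$, $M_K$ denotes its exterior and $\mu\in\pi_1(M_K)$ a meridian (well defined up to orientation and conjugation). A representation $\rho:\pi_1(M_K)\to SU(2)$ is trace free if $\mathrm{tr}\,\rho(\mu)=0$. It is binary dihedral if its image is isomorphic to a binary dihedral group. The knot $K$ is called $SU(2)$-simple if every irreducible trace free representation $\pi_1(M_K)\to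 SU(2)$ is binary dihedral. *)

(* Defs.v *)
From HB Require Import structures.
From mathcomp Require Import all_boot all_order all_algebra.
From mathcomp Require Import spectral complex ring zify.
From mathcomp Require Import boolp classical_sets functions reals.

Set Implicit Arguments.
Unset Strict Implicit.
Unset Printing Implicit Defensive.

Import Order.TTheory GRing.Theory Num.Theory.

Local Open Scope ring_scope.

(* The letter [(a, true)] stands for the generator [a], [(a, false)] for its
   inverse. *)
Definition letter (T : Type) : Type := (T * bool)%type.
Definition flip (T : Type) (x : letter T) : letter T := (x.1, ~~ x.2).

Section Presentation.
Variables (T : choiceType) (rels : seq (seq (letter T) * seq (letter T))).

Inductive word_eq : seq (letter T) -> seq (letter T) -> Prop :=
| word_eq_rel u v : (u, v) \in rels -> word_eq u v
| word_eq_cancel x : word_eq [:: x; flip x] [::]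
| word_eq_cat u u' v v' :
    word_eq u u' -> word_eq v v' -> word_eq (u ++ v) (u' ++ v')
| word_eq_refl u : word_eq u u
| word_eq_sym u v : word_eq u v -> word_eq v u
| word_eq_trans u v w : word_eq u v -> word_eq v w -> word_eq u w.

Definition word_eqb (u v : seq (letter T)) : bool := `[< word_eq u v >].

Lemma word_eqb_equiv : equiv_class_of word_eqb.
Proof.
split=> [u|u v|v u w].
- by apply/asboolP; exact: word_eq_refl.
- by apply/asboolP/asboolP; exact: word_eq_sym.
- by move=> /asboolP uv /asboolP vw; apply/asboolP; exact: word_eq_trans uv vw.
Qed.

Canonical word_equiv := EquivRelPack word_eqb_equiv.

Definition presented_group : Type := {eq_quot word_equiv}%qT.

HB.instance Definition _ := Choice.on presented_group.

Definition pg_class (u : seq (letter T)) : presented_group :=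
  (\pi_{eq_quot word_equiv} u)%qT.
Definition pg_word (x : presented_group) : seq (letter T) :=
  repr (x : {eq_quot word_equiv}%qT).

Lemma pg_wordK : cancel pg_word pg_class.
Proof. by move=> x; rewrite /pg_class /pg_word reprK. Qed.

Lemma pg_classP u v : pg_class u = pg_class v <-> word_eq u v.
Proof.
by split=> [/eqquotP /asboolP //|uv]; apply/eqquotP/asboolP.
Qed.

Lemma pg_classK u : word_eq (pg_word (pg_class u)) u.
Proof. by apply/pg_classP; rewrite pg_wordK. Qed.

Definition word_inv (u : seq (letter T)) := rev (map (@flip T) u).

Lemma flipK : involutive (@flip T).
Proof. by case=> a b; rewrite /flip /= negbK. Qed.

Lemma word_invK : involutive word_inv.
Proof.
by move=> u; rewrite /word_inv map_rev revK -map_comp map_id_in // => x _ /=;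
   rewrite flipK.
Qed.

Lemma word_eq_mulV u : word_eq (u ++ word_inv u) [::].
Proof.
elim: u => [|x u IH]; first exact: word_eq_refl.
rewrite /word_inv map_cons rev_cons -cats1 cat_cons catA -cat1s.
apply: word_eq_trans (word_eq_cancel x).
rewrite -[[:: x; flip x]]/([:: x] ++ [::] ++ [:: flip x]).
by apply: word_eq_cat; [exact: word_eq_refl|apply: word_eq_cat => //;
   exact: word_eq_refl].
Qed.

Lemma word_eq_mulVl u : word_eq (word_inv u ++ u) [::].
Proof. by have := word_eq_mulV (word_inv u); rewrite word_invK. Qed.

Lemma word_eq_inv u v : word_eq u v -> word_eq (word_inv u) (word_inv v).
Proof.
move=> uv; apply: word_eq_trans (_ : word_eq _ (word_inv u ++ (v ++ word_inv v))) _.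
  rewrite -[X in word_eq X _]cats0; apply: word_eq_cat; first exact: word_eq_refl.
  by apply: word_eq_sym; exact: word_eq_mulV.
rewrite catA -[X in word_eq _ X]cat0s; apply: word_eq_cat; last exact: word_eq_refl.
apply: word_eq_trans (word_eq_mulVl u); apply: word_eq_cat; first exact: word_eq_refl.
exact: word_eq_sym.
Qed.

Definition pg_mul x y := pg_class (pg_word x ++ pg_word y).
Definition pg_one := pg_class [::].
Definition pg_inv x := pg_class (word_inv (pg_word x)).

Lemma pg_mulE u v : pg_mul (pg_class u) (pg_class v) = pg_class (u ++ v).
Proof. by apply/pg_classP; apply: word_eq_cat; exact: pg_classK. Qed.

Lemma pg_invE u : pg_inv (pg_class u) = pg_class (word_inv u).
Proof. by apply/pg_classP; apply: word_eq_inv; exact: pg_classK. Qed.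

Lemma pg_mulA : associative pg_mul.
Proof.
move=> x y z; rewrite -(pg_wordK x) -(pg_wordK y) -(pg_wordK z).
by rewrite !pg_mulE catA.
Qed.

Lemma pg_mul1 : left_id pg_one pg_mul.
Proof. by move=> x; rewrite -(pg_wordK x) pg_mulE cat0s. Qed.

Lemma pg_mulr1 : right_id pg_one pg_mul.
Proof. by move=> x; rewrite -(pg_wordK x) pg_mulE cats0. Qed.

Lemma pg_mulV : left_inverse pg_one pg_inv pg_mul.
Proof.
move=> x; rewrite -(pg_wordK x) pg_invE pg_mulE.
by apply/pg_classP; exact: word_eq_mulVl.
Qed.

Lemma pg_mulrV : right_inverse pg_one pg_inv pg_mul.
Proof.
move=> x; rewrite -(pg_wordK x) pg_invE pg_mulE.
by apply/pg_classP; exact: word_eq_mulV.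
Qed.

HB.instance Definition _ := isGroup.Build presented_group
  pg_mulA pg_mul1 pg_mulr1 pg_mulV pg_mulrV.

End Presentation.

(* Every arc of a diagram carries an arbitrary reference direction;
   [(a, true)] is [a] with that direction and [(a, false)] is [a] reversed.
   A crossing consists of the over-passing arc [over] and of two under-passing
   arcs; both directions are chosen so that the lower strand arrives along
   [under_in] from the left of [over] and leaves along [under_out] to its
   right. *)
Record crossing (T : Type) := Crossing {
  over : letter T;
  under_in : letter T;
  under_out : letter T }.

(* A pair [(x, y)] in [joins] records that the end of [x] is glued to the
   beginning of [y], away from the crossings. *)
Record diagram := Diagram {
  arc : finType;
  crossings : seq (crossing arc);
  joins : seq (letter arc * letter arc) }.

Definition same_strand (D : diagram) (a b : arc D) : bool :=
  has (fun c => ((under_in c).1 == a) && ((under_out c).1 == b)) (crossings D)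
  || has (fun j => (j.1.1 == a) && (j.2.1 == b)) (joins D).

Definition components (D : diagram) : nat :=
  n_comp (relU (@same_strand D) (fun a b => same_strand b a)) predT.

Definition is_knot (D : diagram) : Prop := components D = 1%N.

Definition wirtinger (D : diagram) :
    seq (seq (letter (arc D)) * seq (letter (arc D))) :=
  [seq ([:: under_out c], [:: over c; under_in c; flip (over c)])
    | c <- crossings D]
  ++ [seq ([:: j.1], [:: j.2]) | j <- joins D].

(* The fundamental group of the exterior of the link, by Wirtinger's
   presentation.  Meridians of both orientations are generators: reversing the
   direction of an arc inverts its generator. *)
Definition link_group (D : diagram) : groupType :=
  presented_group (wirtinger D).

Definition is_meridian (D : diagram) (g : link_group D) : Prop :=
  exists (x : letter (arc D)) (h : link_group D),
    g = ((pg_class (wirtinger D) [:: x] : link_group D) ^ h)%g.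

(* The four ends are directed outwards. *)
Record tangle := Tangle {
  tarc : finType;
  tcrossings : seq (crossing tarc);
  nw : letter tarc;
  ne : letter tarc;
  sw : letter tarc;
  se : letter tarc }.

(* Two horizontal arcs, the upper one being [true], both directed to the
   right. *)
Definition zero_tangle : tangle :=
  @Tangle bool [::] (true, false) (true, true) (false, false) (false, true).

(* [HTwist e] adds a half twist of the two right ends, [VTwist e] one of the
   two bottom ends.  In both cases the strand on top runs from SW to NE if [e]
   is true, and from NW to SE if [e] is false. *)
Variant twist := HTwist of bool | VTwist of bool.

Definition up (T : Type) (x : letter T) : letter (option T) := (Some x.1, x.2).
Definition up_crossing (T : Type) (c : crossing T) : crossing (option T) :=
  Crossing (up (over c)) (up (under_in c)) (up (under_out c)).

(* The arc [None] is the new one, directed outwards. *)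
Definition add_twist (t : tangle) (w : twist) : tangle :=
  let new : letter (option (tarc t)) := (None, true) in
  let old := map (@up_crossing _) (tcrossings t) in
  match w with
  | HTwist true =>
      @Tangle (option (tarc t))
        (Crossing (up (se t)) (up (ne t)) new :: old)
        (up (nw t)) (up (se t)) (up (sw t)) new
  | HTwist false =>
      @Tangle (option (tarc t))
        (Crossing (flip (up (ne t))) (up (se t)) new :: old)
        (up (nw t)) new (up (sw t)) (up (ne t))
  | VTwist true =>
      @Tangle (option (tarc t))
        (Crossing (flip (up (se t))) (up (sw t)) new :: old)
        (up (nw t)) (up (ne t)) (up (se t)) new
  | VTwist false =>
      @Tangle (option (tarc t))
        (Crossing (up (sw t)) (up (se t)) new :: old)
        (up (nw t)) (up (ne t)) new (up (sw t))
  end.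

Definition rational_tangle (w : seq twist) : tangle :=
  foldl add_twist zero_tangle w.

(* Slopes [q / p] as homogeneous coordinates [(q, p)]: a horizontal half twist
   changes [q / p] by [1] or [-1], a vertical one changes [p / q] by [1] or
   [-1].  By Conway's theorem the slope determines the rational tangle up to
   isotopy fixing the boundary. *)
Definition twist_slope (s : int * int) (w : twist) : int * int :=
  match w with
  | HTwist e => (s.1 + (if e then s.2 else - s.2), s.2)
  | VTwist e => (s.1, s.2 + (if e then s.1 else - s.1))
  end.

Definition slope (w : seq twist) : int * int := foldl twist_slope (0, 1) w.

Definition has_slope (w : seq twist) (q p : int) : Prop :=
  (slope w).1 * p = q * (slope w).2.

Lemma slope_rcons w t : slope (rcons w t) = twist_slope (slope w) t.
Proof. by rewrite /slope foldl_rcons. Qed.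

Lemma has_slope_exists (q p : int) :
  coprimez q p -> exists w : seq twist, has_slope w q p.
Proof.
case/coprimezP=> -[u v] /= uv.
suff [w [e|e]] : exists w, slope w = (q, p) \/ slope w = (- q, - p).
- by exists w; rewrite /has_slope e.
- by exists w; rewrite /has_slope e /= mulNr mulrN.
have [N leN] : exists N : nat, (`|q|%N + `|p|%N <= N)%N by exists (`|q|%N + `|p|%N)%N.
elim: N q p u v uv leN => [|N IH] q p u v uv leN.
  have [q0 p0] : q = 0 /\ p = 0 by lia.
  by move: uv; rewrite q0 p0 !mulr0.
have step (e : bool) (h : bool) :
    (let q' := if h then q + (if e then p else - p) else q in
     let p' := if h then p else p + (if e then q else - q) in
     (`|q'|%N + `|p'|%N <= N)%N) ->
    exists w, slope w = (q, p) \/ slope w = (- q, - p).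
  case: h => /= le.
  - have [|w Hw] := IH (q + (if e then p else - p)) p u
        (v + (if e then - u else u)) _ le; first by rewrite -uv; case: (e); ring.
    exists (rcons w (HTwist (~~ e))); rewrite slope_rcons.
    by case: Hw => ->; [left|right]; case: (e); rewrite /=; congr pair; ring.
  - have [|w Hw] := IH q (p + (if e then q else - q))
        (u + (if e then - v else v)) v _ le; first by rewrite -uv; case: (e); ring.
    exists (rcons w (VTwist (~~ e))); rewrite slope_rcons.
    by case: Hw => ->; [left|right]; case: (e); rewrite /=; congr pair; ring.
have [q0|q0] := eqVneq q 0.
  exists [::]; have : p = 1 \/ p = -1.
    have := congr1 absz uv; rewrite q0 mulr0 add0r abszM => /eqP.
    by rewrite muln_eq1 => /andP[_ /eqP]; lia.
  by rewrite q0; case=> ->; [left|right].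
have [p0|p0] := eqVneq p 0.
  exists [:: HTwist true; VTwist false]; have : q = 1 \/ q = -1.
    have := congr1 absz uv; rewrite p0 mulr0 addr0 abszM => /eqP.
    by rewrite muln_eq1 => /andP[_ /eqP]; lia.
  by rewrite p0; case=> ->; [left|right].
have [sq|sq] : 0 < q \/ q < 0 by lia.
all: have [sp|sp] : 0 < p \/ p < 0 by lia.
all: have [le|lt] := leqP `|p|%N `|q|%N.
- by apply: (step false true) => /=; lia.
- by apply: (step false false) => /=; lia.
- by apply: (step true true) => /=; lia.
- by apply: (step true false) => /=; lia.
- by apply: (step true true) => /=; lia.
- by apply: (step true false) => /=; lia.
- by apply: (step false true) => /=; lia.
- by apply: (step false false) => /=; lia.
Qed.

Section Montesinos.
Variables (n : nat) (t : 'I_n -> tangle).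

Definition sum_arc : finType := {i : 'I_n & tarc (t i)}.

Definition inj_arc (i : 'I_n) (x : letter (tarc (t i))) : letter sum_arc :=
  (Tagged (fun j => tarc (t j)) x.1, x.2).

Definition inj_crossing (i : 'I_n) (c : crossing (tarc (t i))) :
    crossing sum_arc :=
  Crossing (inj_arc (over c)) (inj_arc (under_in c)) (inj_arc (under_out c)).

(* [ordS] is the cyclic successor on ['I_n]. *)
Definition cyclic_sum : diagram :=
  @Diagram sum_arc
    (flatten [seq map (@inj_crossing i) (tcrossings (t i)) | i <- enum 'I_n])
    (flatten
       [seq [:: (inj_arc (ne (t i)), flip (inj_arc (nw (t (ordS i)))));
                (inj_arc (se (t i)), flip (inj_arc (sw (t (ordS i)))))]
       | i <- enum 'I_n]).

End Montesinos.

Definition montesinos (n : nat) (w : 'I_n -> seq twist) : diagram :=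
  cyclic_sum (fun i => rational_tangle (w i)).

Section SU2.
Variable R : realType.

Definition in_SU2 (A : 'M[R[i]]_2) : bool :=
  (A \is unitarymx) && (\det A == 1).

Record SU2 : Type := MkSU2 { SU2val :> 'M[R[i]]_2; SU2valP : in_SU2 SU2val }.

HB.instance Definition _ := [isSub for SU2val].
HB.instance Definition _ := [Choice of SU2 by <:].

Lemma in_SU2_mul (A B : SU2) : in_SU2 (SU2val A *m SU2val B).
Proof.
case: A B => A /= /andP[uA /eqP dA] [B /= /andP[uB /eqP dB]].
by apply/andP; split; [exact: mul_unitarymx|rewrite det_mulmx dA dB mulr1].
Qed.

Lemma in_SU2_one : in_SU2 1%:M.
Proof.
apply/andP; split; last by rewrite det1.
by apply/unitarymxP; rewrite trmx1 map_mx1 mulmx1.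
Qed.

Lemma in_SU2_inv (A : SU2) : in_SU2 (invmx (SU2val A)).
Proof.
case: A => A /= /andP[uA /eqP dA]; apply/andP; split; last by rewrite det_inv dA invr1.
by rewrite invmx_unitary // trmxC_unitary.
Qed.

Definition SU2_mul A B := MkSU2 (in_SU2_mul A B).
Definition SU2_one := MkSU2 in_SU2_one.
Definition SU2_inv A := MkSU2 (in_SU2_inv A).

Lemma SU2_unit (A : SU2) : SU2val A \in unitmx.
Proof. by case: A => A /= /andP[_ /eqP dA]; rewrite unitmxE dA unitr1. Qed.

Lemma SU2_mulA : associative SU2_mul.
Proof. by move=> A B C; apply: val_inj; rewrite /= mulmxA. Qed.
Lemma SU2_mul1 : left_id SU2_one SU2_mul.
Proof. by move=> A; apply: val_inj; rewrite /= mul1mx. Qed.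
Lemma SU2_mulr1 : right_id SU2_one SU2_mul.
Proof. by move=> A; apply: val_inj; rewrite /= mulmx1. Qed.
Lemma SU2_mulV : left_inverse SU2_one SU2_inv SU2_mul.
Proof. by move=> A; apply: val_inj; rewrite /= mulVmx // SU2_unit. Qed.
Lemma SU2_mulrV : right_inverse SU2_one SU2_inv SU2_mul.
Proof. by move=> A; apply: val_inj; rewrite /= mulmxV // SU2_unit. Qed.

HB.instance Definition _ := isGroup.Build SU2
  SU2_mulA SU2_mul1 SU2_mulr1 SU2_mulV SU2_mulrV.

(* Of order [4 * m], generated by [diag(z, z^-1)] with [z] a primitive
   [2 * m]-th root of unity and by [[0, 1], [-1, 0]]. *)
Definition binary_dihedral_group (m : nat) : set SU2 :=
  [set A : SU2 | exists z : R[i], z ^+ (2 * m) = 1 /\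
     ((A 0 0 = z /\ A 0 1 = 0 /\ A 1 0 = 0 /\ A 1 1 = z^-1) \/
      (A 0 0 = 0 /\ A 0 1 = z /\ A 1 0 = - z^-1 /\ A 1 1 = 0))]%classic.

Definition isomorphic_subgroups (A B : set SU2) : Prop :=
  exists f : SU2 -> SU2, set_bij A B f /\
    (forall x y, A x -> A y -> f (x * y)%g = (f x * f y)%g).

Section Representations.
Variables (G : groupType) (rho : {multiplicative G -> SU2}).

(* [stablemx] acts on row vectors; the transpose makes [SU2] act on columns. *)
Definition irreducible : Prop :=
  forall V : 'M[R[i]]_2, (forall g : G, stablemx V (rho g : 'M_2)^T) ->
    \rank V = 0%N \/ \rank V = 2%N.

Definition is_binary_dihedral : Prop :=
  exists m : nat, (1 < m)%N /\
    isomorphic_subgroups (range rho) (binary_dihedral_group m).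

End Representations.

Definition trace_free (D : diagram)
    (rho : {multiplicative link_group D -> SU2}) : Prop :=
  forall g : link_group D, is_meridian g -> \tr (rho g : 'M_2) = 0.

Definition SU2_simple (D : diagram) : Prop :=
  forall rho : {multiplicative link_group D -> SU2},
    irreducible rho -> trace_free rho -> is_binary_dihedral rho.

End SU2.

(* Main.v *)
From HB Require Import structures.
From mathcomp Require Import all_boot all_order all_algebra.
From mathcomp Require Import spectral complex ring lra zify.
From mathcomp Require Import boolp classical_sets functions reals trigo.
Require Import Defs.

(** A trace-free element of SU(2) is a unit pure quaternion, that is, a point
    of the 2-sphere; its square is z = -1.  The idea is to look for
    representations that send the two ends on each side of every tangle to the
    same point up to sign.  Such a representation is a closed polygon
    v_0, ..., v_(n-1) on the sphere, the i-th tangle lying over the side from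
    v_i to v_(i+1).  A rational tangle of slope q/p can be filled in exactly
    along the sides for which (v_(i+1) v_i)^p = z d^q, where d = 1 or d = z is
    the sign between the two left ends ([montesinos_coloring]).  This is the
    relation x^p = h^q of the Seifert fibration of the double branched cover,
    with the regular fibre h sent to the centre.  In terms of angles, a side of
    length pi - psi is allowed when |p| psi is a multiple of pi of a prescribed
    parity ([pure_mul_pow]); for d = 1 and p odd, psi = pi is possible and the
    side can be collapsed to a point.

    When three vertices of the polygon are linearly independent, the
    representation is irreducible, since two of the vertices have no common
    eigenvector ([irreducible_noncommuting]), and it is not binary dihedral.
    Indeed the meridians of a knot are all conjugate up to inversion, so in a
    binary dihedral group they lie all inside or all outside the cyclic
    subgroup of index 2; in both cases any three of them satisfy
    x y w = w y x ([binary_dihedral_meridians]), which for pure quaternions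
    means that x, y and w are coplanar ([polygon_not_SU2_simple]).

    It remains to find such a polygon.  A triangle with three sides taken from
    the tangles 0, 1 and k, all other sides being collapsed, exists when the
    angles psi satisfy the inequalities of the angles of a spherical triangle
    ([spherical_triangle]).  For d = 1 the angles psi are the odd multiples of
    pi/|p|, and suitable ones, close to pi/2 in general, exist as soon as at
    most one of the three |p| is even and they are not all equal to 3
    ([odd_anglesP]).  A knot has at most one even p, and an odd sum of the q
    when all p are odd ([knot_at_most_one_even], [knot_odd_numerators]):
    otherwise the coloring construction with values in Z/2 would give a
    non-constant labelling of the strands.  If every |p| is 3, the triangle
    exists with d = z for n = 3, because the sum of the q is odd, and for n > 3
    a quadrilateral whose four sides have length 2 pi/3, folded along a diagonal
    of length 0, does the job. *)

Set Implicit Arguments.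
Unset Strict Implicit.
Unset Printing Implicit Defensive.

Import Order.TTheory GRing.Theory Num.Theory.

Local Open Scope ring_scope.

(** * Integer powers in a group *)

Section IntegerPowers.
Local Open Scope group_scope.
Variable G : groupType.
Implicit Types (x y : G) (m n : int).

Definition expz x n : G :=
  match n with Posz k => x ^+ k | Negz k => x ^- k.+1 end.

Lemma expzS x n : expz x (n + 1)%R = expz x n * x.
Proof.
case: n => [k|[|k]].
- by rewrite -PoszD addn1 /= expgSr.
- by rewrite /= expg1 mulVg.
have -> : (Negz k.+1 + 1)%R = Negz k by lia.
by rewrite /= [X in _ = X^-1 * _]expgS invgM mulgVK.
Qed.

Lemma expzB1 x n : expz x (n - 1)%R = expz x n * x^-1.
Proof. by rewrite -[in RHS](subrK 1%R n) expzS mulgK. Qed.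

Lemma expzD x m n : expz x (m + n)%R = expz x m * expz x n.
Proof.
elim/int_ind: n => [|n IH|n IH].
- by rewrite addr0 mulg1.
- by rewrite -addn1 PoszD addrA !expzS IH mulgA.
- by rewrite -addn1 PoszD opprD addrA !expzB1 IH mulgA.
Qed.

Lemma expzM x y n : commute x y -> expz (x * y) n = expz x n * expz y n.
Proof.
move=> xy; case: n => k /=; rewrite expgMn //.
by rewrite (commuteX2 _ _ xy) invgM.
Qed.

Lemma expzV x n : expz x^-1 n = (expz x n)^-1.
Proof. by case: n => k /=; rewrite expVgn. Qed.

End IntegerPowers.

(** * Wirtinger colorings of rational tangles *)

Section Colorings.
Local Open Scope group_scope.
Variable G : groupType.

Definition letter_value T (f : T -> G) (x : letter T) : G :=
  if x.2 then f x.1 else (f x.1)^-1.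

Definition wirtinger_at T (f : T -> G) (c : crossing T) : bool :=
  letter_value f (under_out c) ==
  letter_value f (over c) * letter_value f (under_in c)
    * (letter_value f (over c))^-1.

Lemma letter_value_flip T (f : T -> G) x :
  letter_value f (flip x) = (letter_value f x)^-1.
Proof. by case: x => a [] //=; rewrite /letter_value /= invgK. Qed.

Lemma letter_value_up T (f : option T -> G) x :
  letter_value f (up x) = letter_value (fun x => f (Some x)) x.
Proof. by []. Qed.

Lemma all_up_crossing T (f : option T -> G) s :
  all (wirtinger_at f) (map (@up_crossing _) s)
  = all (wirtinger_at (fun x => f (Some x))) s.
Proof. by rewrite all_map. Qed.

Lemma invertedV (a x : G) : a * x = x^-1 * a -> a * x^-1 = x^-1^-1 * a.
Proof.
by move=> ax; apply: (mulIg x); rewrite mulgVK -mulgA ax invgK mulVKg.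
Qed.

Lemma invertedM (a x y : G) : commute x y ->
  a * x = x^-1 * a -> a * y = y^-1 * a -> a * (x * y) = (x * y)^-1 * a.
Proof. by move=> xy ax ay; rewrite mulgA ax -mulgA ay mulgA -invgM xy. Qed.

(** The crossing relation, read on the reflections [x * a] of a generalized
    dihedral group: it is [x, y |-> 2 x - y] on the rotation parts. *)
Lemma dihedral_conj (a x y : G) : commute x y ->
  a * x = x^-1 * a -> a * y = y^-1 * a ->
  x * a * (y * a) * (x * a)^-1 = x * x * y^-1 * a.
Proof.
move=> xy ax ay; have axV : a * x^-1 = x * a.
  by apply: (mulIg x); rewrite mulgVK -mulgA ax mulVKg.
rewrite invgM !mulgA mulgK -[x * a * y]mulgA ay -!mulgA axV.
by congr (_ * _); rewrite !mulgA (commuteV xy).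
Qed.

(** Conjugation by an element with central square is an involution; over-passing
    arcs may therefore be traversed in either direction. *)
Lemma sqr_central_conjV (z g y : G) : (forall u, commute z u) -> g * g = z ->
  g^-1 * y * g = g * y * g^-1.
Proof.
move=> zC gg; apply: (mulgI g); apply: (mulIg g).
by rewrite !mulgA mulgVK mulgV mul1g -[y * g * g]mulgA !gg -zC.
Qed.

Lemma dihedral_conjV (z a x y : G) : (forall u, commute z u) -> a * a = z ->
  commute x y -> a * x = x^-1 * a -> a * y = y^-1 * a ->
  (x * a)^-1 * (y * a) * (x * a) = x * x * y^-1 * a.
Proof.
move=> zC aa xy ax ay; rewrite -dihedral_conj //.
apply: (sqr_central_conjV _ zC).
by rewrite mulgA -[x * a * x]mulgA ax mulVKg.
Qed.

(** All the arcs of the tangle receive reflections [x * a], with [x] a rotation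
    inverted by [a].  The ratio [d] of the two left ends and the ratio [y] of
    the two upper ends determine the four ends.  A horizontal twist multiplies
    [y] by [d] or its inverse and fixes [d]; a vertical twist does the same
    with the roles exchanged.  Since the slope [(q, p)] changes in the same
    way, the relation [y^p = z d^q] is invariant under twists, and for the tangle
    with two horizontal arcs it is the obvious condition [y = z]: this is an
    induction in which the twists are removed one by one. *)
Lemma rational_tangle_coloring (z a : G) (w : seq twist) :
  (forall x, commute z x) -> z * z = 1 -> a * a = z ->
  forall d y, commute d y -> a * d = d^-1 * a -> a * y = y^-1 * a ->
  expz y (slope w).2 = z * expz d (slope w).1 ->
  exists f : tarc (rational_tangle w) -> G,
    [/\ all (wirtinger_at f) (tcrossings (rational_tangle w)),
        letter_value f (nw (rational_tangle w)) = a,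
        letter_value f (ne (rational_tangle w)) = y * a,
        letter_value f (sw (rational_tangle w)) = d * a &
        letter_value f (se (rational_tangle w)) = d * (y * a)].
Proof.
move=> zC zz aa.
have aV : z * a = a^-1 by apply: (mulIg a); rewrite mulVg -mulgA aa.
elim/last_ind: w => [|w t IH] d y dy ad ay.
  rewrite /slope /= expg1 expg0 mulg1 => ->.
  exists (fun b : bool => if b then a^-1 else (d * a)^-1) => /=.
  rewrite /letter_value /= !invgK aV; split=> //.
  by apply: (mulIg a); rewrite invgM -mulgA -ad mulKg mulgVK.
rewrite slope_rcons /rational_tangle foldl_rcons -/(rational_tangle w).
have dyV : commute d y^-1 := commuteV dy.
have ayV : a * y^-1 = y^-1^-1 * a := invertedV ay.
have adV : a * d^-1 = d^-1^-1 * a := invertedV ad.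
have twist_over := @dihedral_conj a; have twist_overV := @dihedral_conjV z a.
case: t => [[]|[]] /= Hy.
- have ydV : commute y d^-1 by apply: commuteV.
  have d_yd : d * (y * d^-1) = y by rewrite mulgA dy mulgK.
  have [|||| f [fc fnw fne fsw fse]] := IH d (y * d^-1).
  + by apply: commuteM => //; apply: commuteV.
  + exact: ad.
  + exact: invertedM.
  + by rewrite expzM // Hy expzV expzD mulgA mulgK.
  exists (fun o => if o is Some x then f x else d * (y * a)) => /=.
  rewrite all_up_crossing fc andbT /wirtinger_at /=.
  rewrite !letter_value_up /= fnw fne fsw fse {1 2}/letter_value /=.
  rewrite [d * (y / d * a)]mulgA d_yd; split=> //; rewrite twist_over //.
  + by rewrite invgM invgK dyV !mulgA mulgK dy.
  + by apply: commuteM.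
  + exact: invertedM.
- have [|||| f [fc fnw fne fsw fse]] := IH d (y * d).
  + exact: commuteM.
  + exact: ad.
  + by apply: invertedM => //; apply: commute_sym.
  + rewrite expzM; last exact: commute_sym.
    by rewrite Hy -mulgA -expzD subrK.
  exists (fun o => if o is Some x then f x else y * a) => /=.
  rewrite all_up_crossing fc andbT /wirtinger_at /= letter_value_flip.
  rewrite !letter_value_up /= fnw fne fsw fse {1 2}/letter_value /= invgK.
  split=> //.
  + have ydd : commute (y * d) d by apply: commute_sym; apply: commuteM.
    have adyd : a * (y * d) = (y * d)^-1 * a.
      by apply: invertedM => //; apply: commute_sym.
    rewrite [d * (_ * a)]mulgA -(ydd) twist_overV //.
    * by rewrite !invgM !mulgA mulgK -[y * d * y]mulgA dy !mulgA !mulgK.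
    * exact: commuteM.
    * exact: invertedM.
  + by rewrite -dy mulgA.
- have d_yd : d * y^-1 * y = d by rewrite mulgVK.
  have [|||| f [fc fnw fne fsw fse]] := IH (d * y^-1) y.
  + by apply: commute_sym; apply: commuteM; [apply: commute_sym|apply: commuteV].
  + exact: invertedM.
  + exact: ay.
  + by rewrite expzM // expzV mulgA -Hy expzD mulgK.
  exists (fun o => if o is Some x then f x else d * (y * a)) => /=.
  rewrite all_up_crossing fc andbT /wirtinger_at /= letter_value_flip.
  rewrite !letter_value_up /= fnw fne fsw fse {1 2}/letter_value /= invgK.
  rewrite [d / y * (y * a)]mulgA d_yd; split=> //; rewrite twist_overV //.
  + by rewrite invgM invgK [y * d^-1](commuteV (commute_sym dy)) !mulgA mulgK.
  + by apply: commuteM => //; apply: commuteV.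
  + exact: invertedM.
- have [|||| f [fc fnw fne fsw fse]] := IH (d * y) y.
  + by apply: commute_sym; apply: commuteM; [apply: commute_sym|].
  + exact: invertedM.
  + exact: ay.
  + by rewrite expzM // mulgA -Hy -expzD subrK.
  exists (fun o => if o is Some x then f x else d * a) => /=.
  rewrite all_up_crossing fc andbT /wirtinger_at /=.
  rewrite !letter_value_up /= fnw fne fsw fse {1 2}/letter_value /=.
  split=> //.
  + have dyy : commute (d * y) y.
      by apply: commute_sym; apply: commuteM => //; apply: commute_sym.
    rewrite [d * y * (_ * a)]mulgA twist_over //.
    * by rewrite !invgM !mulgA mulgK -[d * y * d]mulgA -dy !mulgA !mulgK.
    * exact: commuteM.
    * exact: invertedM.
    * by apply: invertedM => //; apply: invertedM.
  + by rewrite mulgA.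
Qed.

(** * Colorings of Montesinos links *)

Lemma all_flatten T (P : pred T) (ss : seq (seq T)) :
  all P (flatten ss) = all (all P) ss.
Proof. by elim: ss => //= s ss <-; rewrite all_cat. Qed.

Definition wirtinger_coloring (D : diagram) (f : arc D -> G) : bool :=
  all (wirtinger_at f) (crossings D) &&
  all (fun j => letter_value f j.1 == letter_value f j.2) (joins D).

(** The tangles are glued along the vertices [v]: both right ends of the [i]-th
    tangle and, reversed, both left ends of the next one carry [v (ordS i)], up
    to the central sign [d] for the lower ends.  In the notation of
    [rational_tangle_coloring], [a] is the inverse of [v i] and [y] is
    [v (ordS i) * v i]. *)
Lemma montesinos_coloring (z d : G) (n : nat) (w : 'I_n -> seq twist)
    (v : 'I_n -> G) :
  (forall x, commute z x) -> z * z = 1 ->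
  (forall x, commute d x) -> d * d = 1 ->
  (forall i, v i * v i = z) ->
  (forall i, expz (v (ordS i) * v i) (slope (w i)).2
             = z * expz d (slope (w i)).1) ->
  exists f : arc (montesinos w) -> G, wirtinger_coloring f /\
    forall i,
      letter_value f (inj_arc (t := fun i => rational_tangle (w i))
                        (nw (rational_tangle (w i)))) = (v i)^-1 /\
      letter_value f (inj_arc (t := fun i => rational_tangle (w i))
                        (sw (rational_tangle (w i)))) = d * (v i)^-1.
Proof.
move=> zC zz dC dd vv side.
have vV i : (v i)^-1 = z * v i.
  by apply: (mulIg (v i)); rewrite mulVg -mulgA vv.
have dV : d^-1 = d by apply: (mulgI d); rewrite mulgV dd.
pose T i := rational_tangle (w i).
have tangleP i : exists f : tarc (T i) -> G,
    [/\ all (wirtinger_at f) (tcrossings (T i)),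
        letter_value f (nw (T i)) = (v i)^-1,
        letter_value f (ne (T i)) = v (ordS i),
        letter_value f (sw (T i)) = d * (v i)^-1 &
        letter_value f (se (T i)) = d * v (ordS i)].
  have [||||f] := @rational_tangle_coloring z (v i)^-1 (w i) zC zz _
                     d (v (ordS i) * v i) _ _ _ (side i).
  - by rewrite -invgM vv; apply: (mulgI z); rewrite mulgV zz.
  - exact: dC.
  - by rewrite -dC dV.
  - rewrite invgM -mulgA; congr (_ * _); rewrite !vV [z * v (ordS i)]zC.
    by rewrite !mulgA -[v (ordS i) * z * z]mulgA zz mulg1.
  by rewrite mulgK => H; exists f.
pose fT i := projT1 (cid (tangleP i)).
have fTP i := projT2 (cid (tangleP i)).
exists (fun s : sum_arc T => fT (tag s) (tagged s)); split; last first.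
  by move=> i; case: (fTP i).
apply/andP; split.
  rewrite /= all_flatten all_map; apply/allP => i _ /=; rewrite all_map.
  by case: (fTP i).
rewrite /= all_flatten all_map; apply/allP => i _ /=.
have [_ _ ne_i _ se_i] := fTP i; have [_ nw_i _ sw_i _] := fTP (ordS i).
rewrite !letter_value_flip andbT; apply/andP; split; apply/eqP.
  transitivity (v (ordS i)); first exact: ne_i.
  by rewrite [X in X^-1](_ : _ = (v (ordS i))^-1) ?invgK //; exact: nw_i.
transitivity (d * v (ordS i)); first exact: se_i.
rewrite [X in X^-1](_ : _ = d * (v (ordS i))^-1); last exact: sw_i.
by rewrite invgM invgK dV dC.
Qed.

(** * Representations from colorings *)

Definition word_value T (f : T -> G) (u : seq (letter T)) : G :=
  foldr (fun x g => letter_value f x * g) 1 u.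

Lemma word_value_cat T (f : T -> G) u v :
  word_value f (u ++ v) = word_value f u * word_value f v.
Proof. by elim: u => [|x u IH] /=; rewrite ?mul1g // IH mulgA. Qed.

Lemma word_value_wd (D : diagram) (f : arc D -> G) u v :
  wirtinger_coloring f -> word_eq (wirtinger D) u v ->
  word_value f u = word_value f v.
Proof.
case/andP => fc fj; elim=> {u v} => [u v||u u' v v' _ IHu _ IHv|||].
- have relP : all (fun r => word_value f r.1 == word_value f r.2) (wirtinger D).
    rewrite /wirtinger all_cat !all_map; apply/andP; split.
      apply: sub_all fc => c /eqP e.
      by rewrite /= !mulg1 letter_value_flip e !mulgA.
    by apply: sub_all fj => j /eqP e; rewrite /= !mulg1 e.
  by move/(allP relP)/eqP.
- by move=> x; rewrite /= letter_value_flip mulg1 mulgV.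
- by rewrite !word_value_cat IHu IHv.
- by [].
- by move=> u v _ ->.
- by move=> u v x _ -> _ ->.
Qed.

Lemma coloring_representation (D : diagram) (f : arc D -> G) :
  wirtinger_coloring f ->
  exists rho : {multiplicative link_group D -> G},
    forall x, rho (pg_class (wirtinger D) [:: x]) = letter_value f x.
Proof.
move=> fc; pose phi (g : link_group D) := word_value f (pg_word g).
have phiM : {morph phi : x y / x * y >-> x * y}.
  move=> x y; rewrite -word_value_cat; apply: word_value_wd => //.
  exact: pg_classK.
pose m := isMultiplicative.Build (link_group D) G phi phiM.
pose rho : {multiplicative link_group D -> G} := HB.pack phi m.
exists rho => x; rewrite -[RHS]mulg1.
exact: (word_value_wd fc (pg_classK _ _)).
Qed.

End Colorings.

(** * Colorings of knots *)

Section Knots.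

Lemma all_has_exists T (P Q : pred T) (s : seq T) :
  all P s -> has Q s -> exists x, P x /\ Q x.
Proof.
elim: s => //= x s IH /andP[Px Ps] /orP[Qx|]; first by exists x.
exact: IH.
Qed.

Lemma knot_label_constant (D : diagram) (T : eqType) (lab : arc D -> T) :
  is_knot D ->
  all (fun c => lab (under_in c).1 == lab (under_out c).1) (crossings D) ->
  all (fun j => lab j.1.1 == lab j.2.1) (joins D) ->
  forall a b, lab a = lab b.
Proof.
move=> knotD labc labj a b.
set e := relU (@same_strand D) (fun a b => same_strand b a).
have lab_strand x y : same_strand x y -> lab x = lab y.
  case/orP => [/(all_has_exists labc)[c]|/(all_has_exists labj)[c]].
    by case=> /eqP h /andP[/eqP <- /eqP <-].
  by case=> /eqP h /andP[/eqP <- /eqP <-].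
have e_sym : connect_sym e.
  by apply: sym_connect_sym => x y; rewrite /e /= orbC.
have lab_connect x y : connect e x y -> lab x = lab y.
  case/connectP => p; elim: p x => [|z p IH] x /= => [_ -> //|].
  case/andP => exz ezp /(IH _ ezp) <-.
  by case/orP: exz => /lab_strand.
apply: lab_connect; rewrite -(root_connect e_sym); apply/eqP.
have /card1P[r rootsE] : n_comp e predT == 1%N by apply/eqP.
have rootE x : fingraph.root e x = r.
  by apply/eqP; have := rootsE (fingraph.root e x); rewrite !inE roots_root.
by rewrite !rootE.
Qed.

Local Open Scope group_scope.

(** At a crossing the lower strand is conjugated by the upper one, so the
    conjugacy class of the meridians, up to inversion, is carried along the whole
    knot. *)
Lemma class_coloring_constant (D : diagram) (G : groupType) (T : eqType)
    (f : arc D -> G) (chi : G -> T) :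
  is_knot D -> wirtinger_coloring f ->
  (forall x, chi x^-1 = chi x) -> (forall x y, chi (x * y * x^-1) = chi y) ->
  forall x y : letter (arc D), chi (letter_value f x) = chi (letter_value f y).
Proof.
move=> knotD /andP[fc fj] chiV chiJ.
have chiE x : chi (letter_value f x) = chi (f x.1).
  by rewrite /letter_value; case: ifP.
have const : forall a b, chi (f a) = chi (f b).
  apply: (@knot_label_constant D T (chi \o f) knotD).
    by apply: sub_all fc => c /eqP e /=; rewrite -!chiE e chiJ.
  by apply: sub_all fj => j /eqP e /=; rewrite -!chiE e.
by move=> x y; rewrite !chiE.
Qed.

Lemma expz_involution (G : groupType) (x : G) (k : int) :
  x * x = 1 -> expz x k = if odd `|k| then x else 1.
Proof.
move=> xx; have xn n : x ^+ n = if odd n then x else 1.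
  by elim: n => //= n IH; rewrite expgS IH; case: odd; rewrite ?mulg1.
have xV : x^-1 = x by apply: (mulgI x); rewrite mulgV xx.
by case: k => k; rewrite /= xn //=; case: odd; rewrite /= ?invg1.
Qed.

(** * Parity of the slopes of a knot *)

Let Z2 : groupType := 'Z_2.
Let g : Z2 := (1%R : 'Z_2).

Let g_neq1 : g != 1. Proof. by []. Qed.
Let Z2xx (x : Z2) : x * x = 1.
Proof. by case: x => [[|[|[]]] //] lt2; apply: val_inj. Qed.
Let Z2C (x y : Z2) : commute x y.
Proof. exact: Zp_mulgC. Qed.

Lemma Z2_coloring_constant (D : diagram) (f : arc D -> Z2) :
  is_knot D -> wirtinger_coloring f ->
  forall x y : letter (arc D), letter_value f x = letter_value f y.
Proof.
move=> knotD fc; apply: (class_coloring_constant (chi := id) knotD fc) => x.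
  by apply: (mulgI x); rewrite mulgV Z2xx.
by move=> y; rewrite Z2C mulKg.
Qed.

Lemma ordS_val n (i : 'I_n) :
  (ordS i : nat) = i.+1 \/ (ordS i : nat) = 0%N /\ i.+1 = n.
Proof.
have := ltn_ord i; rewrite leq_eqVlt => /orP[/eqP e|lt].
  by right; rewrite /= e modnn.
by left; rewrite /= modn_small.
Qed.

(** The strands of a tangle with even [p] connect its two left ends and its two
    right ends, so that the two sides may be colored differently; with two such
    tangles the color changes and changes back. *)
Lemma knot_at_most_one_even n (w : 'I_n -> seq twist) (i j : 'I_n) :
  is_knot (montesinos w) -> (i < j)%N ->
  odd `|(slope (w i)).2| || odd `|(slope (w j)).2|.
Proof.
move=> knotK lt_ij; apply/norP => -[evi evj].
pose v (l : 'I_n) : Z2 := if (i < l <= j)%N then g else 1.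
have [i'|l|f [fc fw]] := @montesinos_coloring Z2 1 1 n w v
  (Z2C 1) (mulg1 1) (Z2C 1) (mulg1 1).
  exact: Z2xx.
  rewrite !expz_involution // if_same mulg1.
  have [->|ni] := eqVneq l i; first by rewrite (negPf evi).
  have [->|nj] := eqVneq l j; first by rewrite (negPf evj).
  suff -> : v (ordS l) = v l by rewrite Z2xx if_same.
  rewrite /v; suff -> : (i < ordS l <= j)%N = (i < l <= j)%N by [].
  move: ni nj; rewrite -!val_eqE => /eqP/= ni /eqP/= nj.
  have ltj := ltn_ord j; have ltl := ltn_ord l.
  by have /= [-> |[-> e]] := ordS_val l; lia.
have := Z2_coloring_constant knotK fc
  (inj_arc (t := fun i => rational_tangle (w i)) (nw (rational_tangle (w i))))
  (inj_arc (t := fun i => rational_tangle (w i)) (nw (rational_tangle (w j)))).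
rewrite (fw i).1 (fw j).1 /v ltnn /= lt_ij leqnn invg1 => /esym/eqP.
by rewrite invg_eq1 (negPf g_neq1).
Qed.

(** With [d] the non-trivial element the two left ends of a tangle have different
    colors.  The color of the upper end changes at the [i]-th tangle according
    to the parity of [q_i], so it closes up after one turn if the sum of the
    [q_i] is even. *)
Lemma knot_odd_numerators n (w : 'I_n -> seq twist) (i0 : 'I_n) :
  is_knot (montesinos w) -> (forall i, odd `|(slope (w i)).2|) ->
  odd (\sum_i `|(slope (w i)).1|)%N.
Proof.
pose Q i := (slope (w i)).1; move=> knotK oddP.
apply: contraT => /negPf evQ.
pose s (l : nat) : bool := odd (\sum_(i < n | (i < l)%N) `|Q i|)%N.
pose v (l : 'I_n) : Z2 := if s l then g else 1.
have sS (l : 'I_n) : s l.+1 = odd `|Q l| (+) s l.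
  rewrite /s (bigD1 l) //= oddD; congr (_ (+) odd _).
  by apply: eq_bigl => k; rewrite -val_eqE /=; lia.
have sn : s n = s 0%N.
  rewrite /s [in RHS]big_pred0 // [RHS]/= -evQ; congr odd.
  by apply: eq_bigl => k; rewrite ltn_ord.
have [i'|l|f [fc fw]] := @montesinos_coloring Z2 1 g n w v
  (Z2C 1) (mulg1 1) (Z2C g) (Z2xx g).
  exact: Z2xx.
  have -> : v (ordS l) = if odd `|Q l| (+) s l then g else 1.
    rewrite -sS /v; case: (ordS_val l) => [->//|[-> ->]].
    by rewrite sn.
  rewrite !expz_involution // oddP mul1g /v.
  by case: odd; case: (s l); rewrite /= ?mulg1 ?mul1g ?Z2xx.
have := Z2_coloring_constant knotK fc
  (inj_arc (t := fun i => rational_tangle (w i)) (nw (rational_tangle (w i0))))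
  (inj_arc (t := fun i => rational_tangle (w i)) (sw (rational_tangle (w i0)))).
rewrite (fw i0).1 (fw i0).2 => /esym/eqP.
by rewrite -[X in _ == X]mul1g (inj_eq (mulIg _)) (negPf g_neq1).
Qed.

End Knots.

(** * Two by two matrices *)

Section Matrices2.

Lemma lift00 : lift 0 0 = 1 :> 'I_2. Proof. exact: val_inj. Qed.
Lemma lift10 : lift 1 0 = 0 :> 'I_2. Proof. exact: val_inj. Qed.

Lemma det_mx2 (K : comNzRingType) (A : 'M[K]_2) :
  \det A = A 0 0 * A 1 1 - A 0 1 * A 1 0.
Proof.
rewrite (expand_det_row _ 0) !big_ord_recl big_ord0 /cofactor !det_mx11 !mxE.
rewrite lift00 lift10 /bump /= expr0 expr1 mul1r addr0 mulN1r mulrN.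
by [].
Qed.

Lemma mulmx2 (K : comNzRingType) (A B : 'M[K]_2) i j :
  (A *m B) i j = A i 0 * B 0 j + A i 1 * B 1 j.
Proof. by rewrite mxE !big_ord_recl big_ord0 lift00 addr0. Qed.

Lemma mxtrace2 (K : comNzRingType) (A : 'M[K]_2) : \tr A = A 0 0 + A 1 1.
Proof. by rewrite /mxtrace !big_ord_recl big_ord0 lift00 addr0. Qed.

Lemma mx2_ext (K : nmodType) (A B : 'M[K]_2) :
  A 0 0 = B 0 0 -> A 0 1 = B 0 1 -> A 1 0 = B 1 0 -> A 1 1 = B 1 1 -> A = B.
Proof.
move=> e00 e01 e10 e11; apply/matrixP => i j.
have ord2 (k : 'I_2) : k = 0 \/ k = 1.
  by case: k => [[|[|//]] lt]; [left|right]; apply: val_inj.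
by have [-> | ->] := ord2 i; have [-> | ->] := ord2 j.
Qed.

End Matrices2.

(** * Quaternions *)

Section Quaternions.
Variable R : realType.

(** The matrix of the quaternion [a + b i + c j + d k]. *)
Definition quat (a b c d : R) : 'M[R[i]]_2 :=
  \matrix_(i, j) if i == 0 then (if j == 0 then Complex a b else Complex c d)
                 else (if j == 0 then Complex (- c) d else Complex a (- b)).

Lemma quatM a b c d a' b' c' d' :
  quat a b c d *m quat a' b' c' d' =
  quat (a * a' - b * b' - c * c' - d * d') (a * b' + b * a' + c * d' - d * c')
       (a * c' - b * d' + c * a' + d * b') (a * d' + b * c' - c * b' + d * a').
Proof.
apply/matrixP => i j; rewrite mulmx2 !mxE.
by case: i => [[|[|//]] ?]; case: j => [[|[|//]] ?] /=;
   apply/eqP; rewrite eq_complex /=; apply/andP; split; apply/eqP; ring.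
Qed.

Lemma quatB a b c d a' b' c' d' :
  quat a b c d - quat a' b' c' d' = quat (a - a') (b - b') (c - c') (d - d').
Proof.
apply/matrixP => i j; rewrite !mxE /=.
by case: i => [[|[|//]] ?]; case: j => [[|[|//]] ?] /=;
   apply/eqP; rewrite eq_complex /=; apply/andP; split; apply/eqP; ring.
Qed.

Lemma quat1 : quat 1 0 0 0 = 1%:M.
Proof.
apply/matrixP => i j; rewrite !mxE /=.
by case: i => [[|[|//]] ?]; case: j => [[|[|//]] ?] /=;
   rewrite ?oppr0 ?mulr1n ?mulr0n.
Qed.

Lemma det_quat a b c d :
  \det (quat a b c d) = (a ^+ 2 + b ^+ 2 + c ^+ 2 + d ^+ 2)%:C%C.
Proof.
rewrite det_mx2 !mxE /=.
by apply/eqP; rewrite eq_complex /=; apply/andP; split; apply/eqP; ring.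
Qed.

Lemma quat_inj a b c d a' b' c' d' :
  quat a b c d = quat a' b' c' d' -> [/\ a = a', b = b', c = c' & d = d'].
Proof.
move/matrixP => e; have := e 0 0; have := e 0 1; rewrite !mxE /=.
by case=> -> -> [-> ->].
Qed.

Lemma quat_in_SU2 a b c d :
  a ^+ 2 + b ^+ 2 + c ^+ 2 + d ^+ 2 = 1 -> in_SU2 (quat a b c d).
Proof.
move=> n1; rewrite /in_SU2 det_quat n1 eqxx andbT; apply/unitarymxP.
have -> : ((quat a b c d)^t* )%sesqui = quat a (- b) (- c) (- d).
  apply/matrixP => i j; rewrite !mxE /=.
  by case: i => [[|[|//]] ?]; case: j => [[|[|//]] ?] /=;
   apply/eqP; rewrite eq_complex /=; apply/andP; split; apply/eqP; ring.
by rewrite quatM -quat1; congr quat; rewrite -?n1; ring.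
Qed.

Lemma SU2valM (x y : SU2 R) : SU2val (x * y)%g = SU2val x *m SU2val y.
Proof. by []. Qed.

Definition uquat a b c d (n1 : a ^+ 2 + b ^+ 2 + c ^+ 2 + d ^+ 2 = 1) : SU2 R :=
  MkSU2 (quat_in_SU2 n1).

Lemma minus_one_norm : (-1) ^+ 2 + 0 ^+ 2 + 0 ^+ 2 + 0 ^+ 2 = 1 :> R.
Proof. by rewrite !expr0n /= !addr0 sqrrN expr1n. Qed.

Definition minus_one : SU2 R := uquat minus_one_norm.

Lemma minus_oneE : SU2val minus_one = - 1%:M.
Proof.
rewrite /= -quat1 -[RHS]add0r -(subrr (quat 1 0 0 0)) !quatB.
by congr quat; ring.
Qed.

Lemma minus_oneC (x : SU2 R) : commute minus_one x.
Proof.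
by apply: val_inj; rewrite [LHS]SU2valM [RHS]SU2valM minus_oneE mulNmx mulmxN
  mul1mx mulmx1.
Qed.

Lemma minus_one_sqr : (minus_one * minus_one = 1)%g.
Proof. by apply: val_inj; rewrite /= quatM -quat1; congr quat; ring. Qed.

(** By Cayley-Hamilton, [x^2 = (tr x) x - 1]. *)
Lemma trace_free_sqr (x : SU2 R) : (x * x = minus_one)%g -> \tr (SU2val x) = 0.
Proof.
move=> /(congr1 (@SU2val R)); rewrite minus_oneE SU2valM => xx.
have [_ /eqP] := andP (SU2valP x); rewrite det_mx2 mxtrace2.
have := congr1 (fun A : 'M_2 => A 0 0) xx.
have := congr1 (fun A : 'M_2 => A 1 1) xx.
rewrite !mulmx2 !mxE /=.
move: (SU2val x 0 0) (SU2val x 0 1) (SU2val x 1 0) (SU2val x 1 1).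
move=> a b c d dd aa detx.
have : (a + d) ^+ 2 = 0.
  rewrite (_ : (a + d) ^+ 2 =
    (a * a + b * c) + (c * b + d * d) + (a * d - b * c) *+ 2); last by ring.
  by rewrite aa dd detx; ring.
by move/eqP; rewrite sqrf_eq0 => /eqP.
Qed.

Definition vec := (R * R * R)%type.
Definition dot (u v : vec) : R := u.1.1 * v.1.1 + u.1.2 * v.1.2 + u.2 * v.2.
Definition triple (u v w : vec) : R :=
  u.1.1 * (v.1.2 * w.2 - v.2 * w.1.2) + u.1.2 * (v.2 * w.1.1 - v.1.1 * w.2)
  + u.2 * (v.1.1 * w.1.2 - v.1.2 * w.1.1).

Lemma pure_norm (u : vec) : dot u u = 1 ->
  0 ^+ 2 + u.1.1 ^+ 2 + u.1.2 ^+ 2 + u.2 ^+ 2 = 1.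
Proof. by rewrite /dot => <-; ring. Qed.

Definition pureSU2 u (u1 : dot u u = 1) : SU2 R := uquat (pure_norm u1).

Lemma pureSU2_sqr u (u1 : dot u u = 1) : (pureSU2 u1 * pureSU2 u1 = minus_one)%g.
Proof.
by apply: val_inj; rewrite /= quatM; congr quat; rewrite -?u1 /dot; ring.
Qed.

(** De Moivre's formula; the unit pure quaternion [(b, c, d)] plays the role of
    the imaginary unit. *)
Lemma quat_pow psi b c d k : b ^+ 2 + c ^+ 2 + d ^+ 2 = 1 ->
  forall x : SU2 R,
  SU2val x = quat (cos psi) (sin psi * b) (sin psi * c) (sin psi * d) ->
  SU2val (x ^+ k)%g =
  quat (cos (psi *+ k)) (sin (psi *+ k) * b) (sin (psi *+ k) * c)
       (sin (psi *+ k) * d).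
Proof.
move=> n1 x xE; elim: k => [|k IH].
  by rewrite mulr0n cos0 sin0 !mul0r quat1.
rewrite expgS /= IH xE quatM mulrS cosD sinD.
have -> : cos psi * cos (psi *+ k) - sin psi * sin (psi *+ k) =
  cos psi * cos (psi *+ k)
  - sin psi * sin (psi *+ k) * (b ^+ 2 + c ^+ 2 + d ^+ 2) by rewrite n1 mulr1.
by congr quat; ring.
Qed.

Lemma cos_npi j : cos (pi *+ j) = (-1) ^+ j :> R.
Proof.
by elim: j => [|j IH]; rewrite ?mulr0n ?cos0 // mulrSr cosDpi IH exprS mulN1r.
Qed.

Lemma sin_npi j : sin (pi *+ j) = 0 :> R.
Proof. by elim: j => [|j IH]; rewrite ?mulr0n ?sin0 // mulrSr sinDpi IH oppr0. Qed.

(** The product [v u] has real part [- dot u v] and imaginary part the cross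
    product, so it is [cos psi + n sin psi] for a unit pure quaternion [n], and
    De Moivre's formula applies with [k psi] a multiple of [pi]. *)
Lemma pure_mul_pow (u v : vec) (u1 : dot u u = 1) (v1 : dot v v = 1) psi k j :
  dot u v = - cos psi -> psi *+ k = pi *+ j ->
  ((pureSU2 v1 * pureSU2 u1) ^+ k = if odd j then minus_one else 1)%g.
Proof.
move=> uv psik.
pose X := v.1.2 * u.2 - v.2 * u.1.2; pose Y := v.2 * u.1.1 - v.1.1 * u.2.
pose Z := v.1.1 * u.1.2 - v.1.2 * u.1.1.
have vuE : SU2val (pureSU2 v1 * pureSU2 u1)%g = quat (cos psi) X Y Z.
  have -> : cos psi = - dot u v by rewrite uv opprK.
  by rewrite SU2valM quatM /X /Y /Z /dot; congr quat; ring.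
have XYZ : X ^+ 2 + Y ^+ 2 + Z ^+ 2 = sin psi ^+ 2.
  have -> : X ^+ 2 + Y ^+ 2 + Z ^+ 2 = dot u u * dot v v - dot u v ^+ 2.
    by rewrite /dot /X /Y /Z; ring.
  by rewrite u1 v1 uv sqrrN mulr1 sin2cos2.
have [b [c [d [n1 [bX cY dZ]]]]] : exists b c d, b ^+ 2 + c ^+ 2 + d ^+ 2 = 1 /\
    [/\ X = sin psi * b, Y = sin psi * c & Z = sin psi * d].
  have [s0|s0] := eqVneq (sin psi) 0.
    (* The product is 1 or -1, and any axis will do. *)
    exists 1, 0, 0; rewrite s0 !mul0r; split; first by ring.
    move: XYZ; rewrite s0 expr0n /= => XYZ.
    by split; apply/eqP; rewrite -sqrf_eq0; nra.
  exists (X / sin psi), (Y / sin psi), (Z / sin psi).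
  split; last by split; field.
  have -> : (X / sin psi) ^+ 2 + (Y / sin psi) ^+ 2 + (Z / sin psi) ^+ 2 =
    (X ^+ 2 + Y ^+ 2 + Z ^+ 2) / sin psi ^+ 2 by field.
  by rewrite XYZ divff // sqrf_eq0.
rewrite bX cY dZ in vuE; apply: val_inj.
apply: etrans (quat_pow k n1 vuE) _; rewrite psik cos_npi sin_npi !mul0r.
by rewrite -signr_odd; case: (odd j); rewrite /= ?expr1 ?expr0 ?quat1.
Qed.

(** Conjugation of quaternions exchanges the two sides up to sign, so their
    difference is twice the real part of [u v w], which is [- triple u v w]. *)
Lemma pure_triple (u v w : vec) (u1 : dot u u = 1) (v1 : dot v v = 1)
    (w1 : dot w w = 1) :
  (pureSU2 u1 * pureSU2 v1 * pureSU2 w1 =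
   pureSU2 w1 * pureSU2 v1 * pureSU2 u1)%g ->
  triple u v w = 0.
Proof.
move=> /(congr1 (@SU2val R)); rewrite !SU2valM /= !quatM => /quat_inj[+ _ _ _].
by rewrite /triple; lra.
Qed.

(** The commutator is twice the cross product of [u] and [v], whose scalar
    product with [w] is [triple u v w]. *)
Lemma pure_commutator_det (u v w : vec) (u1 : dot u u = 1) (v1 : dot v v = 1) :
  triple u v w != 0 ->
  \det (SU2val (pureSU2 u1) *m SU2val (pureSU2 v1)
        - SU2val (pureSU2 v1) *m SU2val (pureSU2 u1)) != 0.
Proof.
apply: contra_neq; rewrite /= !quatM quatB det_quat => -[].
rewrite /triple => e.
set X := u.1.2 * v.2 - u.2 * v.1.2; set Y := u.2 * v.1.1 - u.1.1 * v.2.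
set Z := u.1.1 * v.1.2 - u.1.2 * v.1.1.
have e4 : 4 * (X ^+ 2 + Y ^+ 2 + Z ^+ 2) = 0 by rewrite -[RHS]e /X /Y /Z; ring.
have [] : [/\ X = 0, Y = 0 & Z = 0].
  have := sqr_ge0 X; have := sqr_ge0 Y; have := sqr_ge0 Z => Z0 Y0 X0.
  by split; apply/eqP; rewrite -sqrf_eq0; apply/eqP; lra.
rewrite /X /Y /Z => e1 e2 e3.
rewrite (_ : _ + _ = (u.1.2 * v.2 - u.2 * v.1.2) * w.1.1
  + (u.2 * v.1.1 - u.1.1 * v.2) * w.1.2 + (u.1.1 * v.1.2 - u.1.2 * v.1.1) * w.2).
  by rewrite e1 e2 e3 !mul0r !addr0.
ring.
Qed.

(** On an invariant line [rho g] and [rho h] act by scalars, so that their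
    commutator kills it and is singular. *)
Lemma irreducible_noncommuting (G : groupType)
    (rho : {multiplicative G -> SU2 R}) g h :
  \det (SU2val (rho g) *m SU2val (rho h) - SU2val (rho h) *m SU2val (rho g)) != 0 ->
  irreducible rho.
Proof.
move=> detN0 V stab; have := rank_leq_row V.
case rV : (\rank V) => [|[|[|//]]] _; [by left| |by right].
have VN0 : V != 0 by rewrite -mxrank_eq0 rV.
pose v := nz_row V.
have vN0 : v != 0 by rewrite nz_row_eq0.
have vV : (v <= V)%MS := nz_row_sub V.
have Vv : (V <= v)%MS.
  by rewrite -(mxrank_leqif_sup vV) rV rank_rV vN0.
have eigen x : exists a, v *m (SU2val (rho x))^T = a *: v.
  apply/sub_rVP; apply: submx_trans Vv; apply: submx_trans (stab x).
  exact: submxMr.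
have [a va] := eigen g; have [b vb] := eigen h.
set M := (X in \det X) in detN0.
have vM : v *m M^T = 0.
  rewrite /M linearB /= !trmx_mul mulmxBr !mulmxA va vb -!scalemxAl va vb.
  by rewrite !scalerA mulrC subrr.
have unitM : M^T \in unitmx by rewrite unitmxE det_tr unitfE.
by move: vN0; rewrite -(mulmxK unitM v) vM mul0mx eqxx.
Qed.

(** * Binary dihedral groups *)

Definition antidiagonal (A : SU2 R) : bool := SU2val A 0 1 != 0.

Lemma binary_dihedral_entries m (A : SU2 R) : (1 < m)%N ->
  binary_dihedral_group m A ->
  if antidiagonal A then SU2val A 0 0 = 0 /\ SU2val A 1 1 = 0
  else [/\ SU2val A 0 1 = 0, SU2val A 1 0 = 0, SU2val A 0 0 != 0
        & SU2val A 1 1 != 0].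
Proof.
move=> m1 [z [zm Az]]; have z0 : z != 0.
  apply: contra_eq_neq zm => ->; rewrite expr0n muln_eq0 /=.
  by case: m m1 => //= m _; rewrite eq_sym oner_eq0.
rewrite /antidiagonal.
by case: Az => -[A00 [A01 [A10 A11]]]; rewrite A01 ?eqxx ?z0 // A00 A11 invr_eq0.
Qed.

Lemma antidiagonalM m (A B : SU2 R) : (1 < m)%N ->
  binary_dihedral_group m A -> binary_dihedral_group m B ->
  antidiagonal (A * B)%g = antidiagonal A (+) antidiagonal B.
Proof.
move=> m1 /(binary_dihedral_entries m1) hA /(binary_dihedral_entries m1) hB.
rewrite {1}/antidiagonal SU2valM mulmx2.
case aA: (antidiagonal A) hA; case aB: (antidiagonal B) hB.
- by move=> [_ ->] [-> _]; rewrite mul0r mulr0 addr0 eqxx.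
- move=> [-> _ _ B11] [-> _]; rewrite mul0r add0r mulf_eq0 negb_or B11 andbT.
  exact: aA.
- move=> [_ ->] [_ _ A00 _]; rewrite mulr0 addr0 mulf_eq0 negb_or A00.
  exact: aB.
by move=> [-> _ _ _] [-> _ _ _]; rewrite mul0r mulr0 addr0 eqxx.
Qed.

Lemma diagonal_commute m (A B : SU2 R) : (1 < m)%N ->
  binary_dihedral_group m A -> binary_dihedral_group m B ->
  ~~ antidiagonal A -> ~~ antidiagonal B -> (A * B = B * A)%g.
Proof.
move=> m1 /(binary_dihedral_entries m1) hA /(binary_dihedral_entries m1) hB.
move=> /negPf dA /negPf dB; rewrite dA in hA; rewrite dB in hB.
case: hA hB => A01 A10 _ _ [B01 B10 _ _]; apply: val_inj.
by apply: mx2_ext; rewrite ![val _]SU2valM !mulmx2 ?A01 ?A10 ?B01 ?B10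
  ?mulr0 ?mul0r ?addr0 ?add0r // mulrC.
Qed.

End Quaternions.

(** * Meridians *)

Section Meridians.
Local Open Scope group_scope.

Lemma multiplicativeJ (G H : groupType) (rho : {multiplicative G -> H}) g h :
  rho (g ^ h) = rho g ^ rho h.
Proof. by apply: (mulgI (rho h)); rewrite -gmulfM -!conjgC gmulfM. Qed.

Definition generator (D : diagram) (x : letter (arc D)) : link_group D :=
  pg_class (wirtinger D) [:: x].

Lemma letter_value_generator (D : diagram) (x : letter (arc D)) :
  letter_value (fun a => generator (a, true)) x = generator x.
Proof.
case: x => a [] //; rewrite /letter_value /=.
exact: (pg_invE (wirtinger D) [:: (a, true)]).
Qed.

(** The tautological coloring, through which statements on colorings of knots
    apply to the generators of the link group. *)
Lemma generator_coloring (D : diagram) :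
  wirtinger_coloring (fun a : arc D => generator (a, true)).
Proof.
have relP u v : (u, v) \in wirtinger D ->
    pg_class (wirtinger D) u = pg_class (wirtinger D) v.
  by move=> uv; apply/pg_classP; apply: word_eq_rel.
have gen_cat u v : pg_class (wirtinger D) (u ++ v) =
   (pg_class (wirtinger D) u : link_group D) * pg_class (wirtinger D) v.
  exact: esym (pg_mulE _ _ _).
have genV x : (generator x)^-1 = generator (flip x) :> link_group D.
  exact: (pg_invE (wirtinger D) [:: x]).
have all_rel : all (fun r => (pg_class (wirtinger D) r.1 : link_group D)
    == pg_class (wirtinger D) r.2) (wirtinger D).
  by apply/allP => -[u v] /relP /= ->.
move: all_rel; rewrite {2}/wirtinger all_cat !all_map => /andP[rc rj].
apply/andP; split.
  apply: sub_all rc => c /eqP /= e; rewrite /wirtinger_at !letter_value_generator.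
  rewrite /generator e -cat1s gen_cat -[X in _ * pg_class _ X]cat1s gen_cat.
  by rewrite genV mulgA.
by apply: sub_all rj => j /eqP /= e; rewrite !letter_value_generator /generator e.
Qed.

End Meridians.

(** * Representations from spherical polygons *)

Section Polygons.
Variable R : realType.
Local Open Scope group_scope.

(** Being antidiagonal is a homomorphism [delta] from the image to Z/2 with
    abelian kernel, and it is constant on the meridians of a knot.  If it
    vanishes there, the meridians commute.  If not, the products [y x] and
    [y w] lie in the kernel, and the relation follows by cancelling [y] in
    [y x y w = y w y x]. *)
Lemma binary_dihedral_meridians (D : diagram)
    (rho : {multiplicative link_group D -> SU2 R}) :
  is_knot D -> is_binary_dihedral rho ->
  forall x y w : letter (arc D),
  rho (generator x) * rho (generator y) * rho (generator w) =
  rho (generator w) * rho (generator y) * rho (generator x).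
Proof.
move=> knotD [m [m1 [phi [phi_bij phiM]]]] x y w.
have rangeP g : range rho (rho g) by exists g.
have inBD g : binary_dihedral_group m (phi (rho g)).
  by have [fun_phi _ _] := phi_bij; apply: fun_phi.
have phi_inj g h : phi (rho g) = phi (rho h) -> rho g = rho h.
  by have [_ inj_phi _] := phi_bij => e; apply: inj_phi e; rewrite inE.
pose delta g := antidiagonal (phi (rho g)).
have deltaM g h : delta (g * h) = delta g (+) delta h.
  by rewrite /delta gmulfM phiM // (antidiagonalM m1).
have delta1 : delta 1 = false.
  by have := deltaM 1 1; rewrite mulg1; case: (delta 1).
have deltaV g : delta g^-1 = delta g.
  by have := deltaM g g^-1; rewrite mulgV delta1; case: (delta g); case: (delta _).
have const : forall u v, delta (generator u) = delta (generator v).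
  move=> u v; rewrite -!letter_value_generator.
  apply: class_coloring_constant (generator_coloring D) _ _ u v => // g h.
  by rewrite !deltaM deltaV addbC addbA addbb addFb.
have comm g h : ~~ delta g -> ~~ delta h -> rho g * rho h = rho h * rho g.
  move=> dg dh; rewrite -!gmulfM; apply: phi_inj; rewrite !gmulfM !phiM //.
  exact: (diagonal_commute m1).
case dx: (delta (generator x)).
  have := comm (generator y * generator x) (generator y * generator w).
  rewrite !deltaM !(const _ x) dx => /(_ isT isT).
  by rewrite !gmulfM -!mulgA => /mulgI.
have dN u : ~~ delta (generator u) by rewrite (const u x) dx.
by rewrite (comm _ _ (dN x) (dN y)) -mulgA (comm _ _ (dN x) (dN w)) mulgA
  (comm _ _ (dN y) (dN w)).
Qed.

Lemma expz_abs (G : groupType) (x y : G) (k : int) :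
  x ^+ `|k|%N = y -> y * y = 1 -> expz x k = y.
Proof.
move=> <-; case: k => k //= yy.
by apply: (mulgI (x ^+ k.+1)); rewrite mulgV yy.
Qed.

(** The flag [c] tells whether the central sign [d] is -1. *)
Lemma polygon_not_SU2_simple (n : nat) (w : 'I_n -> seq twist)
    (x : 'I_n -> vec R) (c : bool) :
  is_knot (montesinos w) -> (forall i, dot (x i) (x i) = 1%R) ->
  (forall i, exists psi (j : nat),
     [/\ dot (x i) (x (ordS i)) = (- cos psi)%R,
         (psi *+ `|(slope (w i)).2| = pi *+ j)%R &
         odd j = ~~ (c && odd `|(slope (w i)).1|)]) ->
  (exists i j k, (triple (x i) (x j) (x k) != 0)%R) ->
  ~ SU2_simple R (montesinos w).
Proof.
move=> knotK unitx side [i [j [k noncoplanar]]] simpleK.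
pose z := minus_one R.
pose v l := pureSU2 (unitx l).
pose d := if c then z else 1.
have zz : z * z = 1 := minus_one_sqr R.
have zC y : commute z y := minus_oneC y.
have dd : d * d = 1 by rewrite /d; case: c {side d}; rewrite ?mulg1.
have dC y : commute d y.
  by rewrite /d; case: c {side d dd} => //; apply: commute_sym; apply: commute1.
have vv l : v l * v l = z by apply: pureSU2_sqr.
have [|f [fcol fw]] := montesinos_coloring zC zz dC dd vv (w := w).
  move=> l; have [psi [h [psiP psin hP]]] := side l.
  have := pure_mul_pow (unitx l) (unitx (ordS l)) psiP psin.
  rewrite -/(v l) -/(v (ordS l)) -/z hP => /expz_abs ->; last first.
    by case: ifP; rewrite ?mulg1.
  rewrite expz_involution // /d.
  by case: c {side d dd dC hP} => /=; case: (odd _); rewrite /= ?mulg1 ?zz.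
have [rho rhoE] := coloring_representation fcol.
(* The square of a color is central, hence unchanged along the knot. *)
have sqr_f l : letter_value f l * letter_value f l = z.
  pose l0 := inj_arc (t := fun i => rational_tangle (w i))
    (nw (rational_tangle (w i))).
  apply/eqP; rewrite (class_coloring_constant
    (chi := fun g => g * g == z) knotK fcol _ _ l l0).
  - by rewrite (fw i).1 -invgM vv; apply/eqP; apply: (mulgI z); rewrite mulgV zz.
  - move=> g /=; rewrite -invgM -(inj_eq (@invg_inj _)) invgK.
    by rewrite (_ : z^-1 = z) //; apply: (mulgI z); rewrite mulgV zz.
  move=> g h /=; rewrite !mulgA mulgVK -(inj_eq (mulIg g)) mulgVK zC -!mulgA.
  by rewrite (inj_eq (mulgI g)).
pose nwl l : letter (arc (montesinos w)) :=
  flip (inj_arc (t := fun i => rational_tangle (w i))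
          (nw (rational_tangle (w l)))).
have rho_v l : rho (generator (nwl l)) = v l.
  by rewrite rhoE letter_value_flip (fw l).1 invgK.
have trfree : trace_free rho.
  move=> _ [l [h ->]]; apply: trace_free_sqr.
  rewrite -/(generator l) -/z multiplicativeJ -conjMg rhoE sqr_f.
  by rewrite conjgE zC mulgA mulVg mul1g.
have irr : irreducible rho.
  apply: (@irreducible_noncommuting _ _ rho (generator (nwl i)) (generator (nwl j))).
  by rewrite !rho_v; apply: pure_commutator_det noncoplanar.
have := binary_dihedral_meridians knotK (simpleK rho irr trfree)
  (nwl i) (nwl j) (nwl k).
rewrite !rho_v => /pure_triple e; by rewrite e eqxx in noncoplanar.
Qed.

End Polygons.

(** * Spherical triangles *)

Section Geometry.
Variable R : realType.

(** The angles of a non-degenerate spherical triangle, the straight angle being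
    [t]; the sides of the polar triangle are [t - a], [t - b] and [t - c]. *)
Definition triangle_angles (t a b c : R) : Prop :=
  [/\ 0 < a < t, 0 < b < t & 0 < c < t] /\
  [/\ t < a + b + c, a + b < t + c, b + c < t + a & c + a < t + b].

Lemma cos_lt_norm (a b : R) : `|a| < b -> b <= pi -> cos b < cos a.
Proof.
move=> ab bpi; rewrite -(cos_norm a) ltr_cos // in_itv /=.
  by rewrite normr_ge0 (ltW (lt_le_trans ab bpi)).
by rewrite bpi andbT (le_trans (normr_ge0 a) (ltW ab)).
Qed.

(** With [B] on the first axis and [A] in the first coordinate plane, [C] is
    found by rotating a point at distance [pi - b] from [B] by an angle of cosine
    [k] given by the spherical law of cosines; the hypotheses say that [k] lies
    strictly between -1 and 1. *)
Lemma spherical_triangle (a b c : R) : triangle_angles pi a b c ->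
  exists A B C : vec R,
    [/\ dot A A = 1, dot B B = 1 & dot C C = 1] /\
    [/\ dot A B = - cos a, dot B C = - cos b, dot C A = - cos c &
        triple A B C != 0].
Proof.
move=> [[/andP[a0 api] /andP[b0 bpi] /andP[c0 cpi]] [abc ab bc ca]].
have sa : 0 < sin a by apply: sin_gt0_pi; rewrite a0.
have sb : 0 < sin b by apply: sin_gt0_pi; rewrite b0.
have ub : cos c + cos a * cos b < sin a * sin b.
  have : cos c < cos (pi - (a + b)).
    by apply: cos_lt_norm; [rewrite ltr_norml; apply/andP; split; lra|lra].
  rewrite cosB cospi sinpi cosD; lra.
have lb : - (sin a * sin b) < cos c + cos a * cos b.
  have : cos (pi - c) < cos (a - b).
    by apply: cos_lt_norm; [rewrite ltr_norml; apply/andP; split; lra|lra].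
  rewrite cosB cospi sinpi cosB; lra.
have sab : 0 < sin a * sin b by apply: mulr_gt0.
pose k := - (cos c + cos a * cos b) / (sin a * sin b).
have k1 : k ^+ 2 < 1.
  have : k < 1 by rewrite /k ltr_pdivrMr //; lra.
  have : -1 < k by rewrite /k ltr_pdivlMr //; lra.
  by move=> *; nra.
pose s := Num.sqrt (1 - k ^+ 2).
have s2 : s ^+ 2 = 1 - k ^+ 2 by rewrite sqr_sqrtr //; lra.
have s0 : s != 0 by rewrite sqrtr_eq0 -ltNge; lra.
have kE : sin a * sin b * k = - (cos c + cos a * cos b).
  by rewrite /k mulrC divfK // gt_eqF.
have ca2 := cos2Dsin2 a; have cb2 := cos2Dsin2 b.
exists (- cos a, sin a, 0), (1, 0, 0), (- cos b, sin b * k, sin b * s).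
rewrite /dot /triple /=; split; split; first by rewrite -ca2; ring.
- by ring.
- rewrite (_ : _ + _ = cos b ^+ 2 + sin b ^+ 2 * (k ^+ 2 + s ^+ 2)); last by ring.
  by rewrite (_ : k ^+ 2 + s ^+ 2 = 1) ?mulr1 // s2; ring.
- by ring.
- by ring.
- rewrite (_ : _ + _ = cos a * cos b + sin a * sin b * k); last by ring.
  by rewrite kE; ring.
rewrite (_ : _ + _ = - (sin a * sin b * s)); last by ring.
by rewrite oppr_eq0 !mulf_neq0 // gt_eqF.
Qed.

Lemma triangle_angles_scale (a b c t : R) : 0 < t ->
  triangle_angles 1 a b c -> triangle_angles t (t * a) (t * b) (t * c).
Proof.
move=> t0 [[/andP[a0 a1] /andP[b0 b1] /andP[c0 c1]] [h1 h2 h3 h4]].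
by split; split; try (apply/andP; split); nra.
Qed.

Lemma ratio_le (a b p j : nat) : (0 < p)%N -> (0 < b)%N ->
  (a%:R / b%:R <= j%:R / p%:R :> R) = (a * p <= b * j)%N.
Proof.
move=> p0 b0; rewrite ler_pdivrMr ?ltr0n // mulrAC ler_pdivlMr ?ltr0n //.
by rewrite -!natrM ler_nat [(j * b)%N]mulnC.
Qed.

Lemma ratio_ge (a b p j : nat) : (0 < p)%N -> (0 < b)%N ->
  (j%:R / p%:R <= a%:R / b%:R :> R) = (b * j <= a * p)%N.
Proof. by move=> p0 b0; rewrite ratio_le // mulnC [(p * a)%N]mulnC. Qed.

(** The numerator is the odd one of the two integers nearest to [p / 2]. *)
Lemma odd_near_half p : odd p -> (1 < p)%N -> exists2 j, odd j &
  [/\ 1 / 3 <= j%:R / p%:R :> R, j%:R / p%:R <= 3 / 5 :> R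
    & p <> 3%N -> 3 / 7 <= j%:R / p%:R :> R].
Proof.
move=> oddp p1; have [m pE] : exists m, p = m.*2.+1 by exists p./2; lia.
have [j [oddj h]] : exists j, odd j /\ (j = m \/ j = m.+1).
  by case om: (odd m); [exists m|exists m.+1]; rewrite /= om; auto.
exists j => //; split; [rewrite (@ratio_le 1 3)|rewrite (@ratio_ge 3 5)|
  move=> p3; rewrite (@ratio_le 3 7)]; lia.
Qed.

(** The numerator is [p / 2] or [p / 2 - 1]; for [p = 4] only 1/4 and 3/4 are
    available, which are too far from 1/2. *)
Lemma even_near_half p : ~~ odd p -> (1 < p)%N -> p <> 4%N ->
  exists2 j, odd j & 3 / 8 <= j%:R / p%:R :> R /\ j%:R / p%:R <= 1 / 2 :> R.
Proof.
move=> evp p1 p4; have [m pE] : exists m, p = m.*2 by exists p./2; lia.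
have [j [oddj h]] : exists j, odd j /\ (j = m \/ j.+1 = m).
  case om: (odd m); first by exists m; auto.
  by exists m.-1; case: m om pE {evp} => [|m] //=; [lia|move=> /negbFE; auto].
exists j => //.
by split; [rewrite (@ratio_le 3 8)|rewrite (@ratio_ge 1 2)]; lia.
Qed.

Definition odd_angles (p1 p2 p3 : nat) : Prop := exists j1 j2 j3 : nat,
  [/\ odd j1, odd j2 & odd j3] /\
  triangle_angles 1 (j1%:R / p1%:R) (j2%:R / p2%:R) (j3%:R / p3%:R).

Lemma triangle_angles_near_half (a b c : R) :
  1 / 3 <= a -> a <= 3 / 5 -> 1 / 3 <= b -> b <= 3 / 5 ->
  1 / 3 <= c -> c <= 3 / 5 -> 1 < a + b + c -> triangle_angles 1 a b c.
Proof.
by move=> a1 a2 b1 b2 c1 c2 abc; split; split; try (apply/andP; split); lra.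
Qed.

(** Angles in [1/3, 3/5] form a triangle as soon as their sum exceeds 1.  This
    fails only for three angles 1/3.  For [p1 = 4] the angle 1/4 is used,
    except for (4, 3, 3), where the other two angles are too small and 3/4 is
    taken. *)
Lemma odd_angles_odd23 p1 p2 p3 :
  (1 < p1)%N -> (1 < p2)%N -> (1 < p3)%N -> odd p2 -> odd p3 ->
  ~ [/\ p1 = 3%N, p2 = 3%N & p3 = 3%N] -> odd_angles p1 p2 p3.
Proof.
move=> p1_gt p2_gt p3_gt o2 o3 not333.
have [j2 oj2 [lb2 ub2 nb2]] := odd_near_half o2 p2_gt.
have [j3 oj3 [lb3 ub3 nb3]] := odd_near_half o3 p3_gt.
have [o1|e1] := boolP (odd p1).
  have [j1 oj1 [lb1 ub1 nb1]] := odd_near_half o1 p1_gt.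
  exists j1, j2, j3; split=> //; apply: triangle_angles_near_half => //.
  have [e1|/eqP/nb1 ?] := eqVneq p1 3%N; last by lra.
  have [e2|/eqP/nb2 ?] := eqVneq p2 3%N; last by lra.
  have [e3|/eqP/nb3 ?] := eqVneq p3 3%N; last by lra.
  by case: not333.
have [->|/eqP p1_4] := eqVneq p1 4%N; last first.
  have [j1 oj1 [lb1 ub1]] := even_near_half e1 p1_gt p1_4.
  exists j1, j2, j3; split=> //.
  by apply: triangle_angles_near_half => //; lra.
have [[e2 e3]|big] : (p2 = 3%N /\ p3 = 3%N) \/
    3 / 4 < j2%:R / p2%:R + j3%:R / p3%:R :> R.
- have [e2|/eqP/nb2 ?] := eqVneq p2 3%N; last by right; lra.
  have [e3|/eqP/nb3 ?] := eqVneq p3 3%N; last by right; lra.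
  by left.
- exists 3%N, 1%N, 1%N; rewrite e2 e3; split=> //.
  by split; split; try (apply/andP; split); lra.
exists 1%N, j2, j3; split=> //.
move: lb2 ub2 lb3 ub3 big {nb2 nb3}.
move: (j2%:R / p2%:R) (j3%:R / p3%:R) => b c b1 b2 c1 c2 bc.
by split; split; try (apply/andP; split); lra.
Qed.

Lemma triangle_angles_sym t a b c : triangle_angles t a b c ->
  triangle_angles t b a c /\ triangle_angles t b c a.
Proof. by move=> [[? ? ?] [? ? ? ?]]; split; split; split=> //; lra. Qed.

(** Reduction to the case where only the first denominator may be even. *)
Lemma odd_anglesP p1 p2 p3 :
  (1 < p1)%N -> (1 < p2)%N -> (1 < p3)%N ->
  odd p1 || odd p2 -> odd p1 || odd p3 -> odd p2 || odd p3 ->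
  ~ [/\ p1 = 3%N, p2 = 3%N & p3 = 3%N] -> odd_angles p1 p2 p3.
Proof.
move=> g1 g2 g3 o12 o13 o23 not333.
have [o2|e2] := boolP (odd p2); have [o3|e3] := boolP (odd p3).
- exact: odd_angles_odd23.
- rewrite (negPf e3) orbF in o13.
  have [|j3 [j1 [j2 [[? ? ?] T]]]] := odd_angles_odd23 g3 g1 g2 o13 o2.
    by case=> *; apply: not333.
  by exists j1, j2, j3; split=> //; exact: (triangle_angles_sym T).2.
- rewrite (negPf e2) orbF in o12.
  have [|j2 [j1 [j3 [[? ? ?] T]]]] := odd_angles_odd23 g2 g1 g3 o12 o3.
    by case=> *; apply: not333.
  by exists j1, j2, j3; split=> //; exact: (triangle_angles_sym T).1.
by move: o23; rewrite (negPf e2) (negPf e3).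
Qed.

Lemma angles_333 (q1 q2 q3 : bool) : q1 (+) q2 (+) q3 ->
  let j (q : bool) : nat := if q then 2 else 1 in
  triangle_angles (1 : R) ((j q1)%:R / 3) ((j q2)%:R / 3) ((j q3)%:R / 3).
Proof.
by case: q1; case: q2; case: q3 => //= _;
   split; split; try (apply/andP; split); lra.
Qed.

End Geometry.

(** * Slopes *)

Section Slopes.

Lemma slope_neq0 (w : seq twist) : slope w != (0, 0).
Proof.
elim/last_ind: w => [|w t]; first by [].
rewrite slope_rcons; case: (slope w) => a b; apply: contra_neq.
by case: t => -[] /= [] h1 h2; congr pair; lia.
Qed.

(** As [q] and [p] are coprime, the denominator obtained from the twists is a
    non-zero multiple of [p]. *)
Lemma slope_denominator_gt1 (w : seq twist) (q p : int) :
  1 < `|p| -> coprimez q p -> has_slope w q p -> (1 < `|(slope w).2|)%N.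
Proof.
move=> p1 qp; rewrite /has_slope; have := slope_neq0 w.
case: (slope w) => a b /= ab0 apqb.
have pb : (p %| b)%Z.
  have pqb : (p %| q * b)%Z by rewrite -apqb dvdz_mull.
  by rewrite Gauss_dvdzr // coprimez_sym in pqb.
have b0 : b != 0.
  apply: contra_neq ab0 => b0; move: apqb; rewrite b0 mulr0 => /eqP.
  rewrite mulf_eq0 => /orP[/eqP -> //|/eqP p0].
  by rewrite p0 in p1.
have := dvdn_leq _ pb; rewrite absz_gt0 b0 => /(_ isT).
by move: p1; lia.
Qed.

End Slopes.

(** * Polygons for Montesinos knots *)

Section Assembly.
Variable R : realType.

(** The polygon is the triangle A, B, C with sides over the tangles 0, 1 and k:
    the vertex 0 is A, the vertex 1 is B, the vertices 2 to k are C and the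
    following ones are A again.  The remaining sides are points, that is,
    [psi = pi]. *)
Lemma triangle_not_SU2_simple (n : nat) (w : 'I_n -> seq twist) (c : bool)
    (i0 i1 k : 'I_n) (j0 j1 jk : nat) :
  let P i := `|(slope (w i)).2|%N in let Q i := `|(slope (w i)).1|%N in
  is_knot (montesinos w) -> (forall i, (1 < P i)%N) ->
  i0 = 0%N :> nat -> i1 = 1%N :> nat -> (1 < k)%N ->
  odd j0 = ~~ (c && odd (Q i0)) -> odd j1 = ~~ (c && odd (Q i1)) ->
  odd jk = ~~ (c && odd (Q k)) ->
  triangle_angles (1 : R) (j0%:R / (P i0)%:R) (j1%:R / (P i1)%:R)
    (jk%:R / (P k)%:R) ->
  (forall l, l != i0 -> l != i1 -> l != k -> odd (P l) && ~~ c) ->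
  ~ SU2_simple R (montesinos w).
Proof.
move=> P Q knotK P1 i0E i1E k1 oj0 oj1 ojk angles others.
have [A [B [C [[A1 B1 C1] [AB BC CA ABC]]]]] :=
  spherical_triangle (triangle_angles_scale (pi_gt0 R) angles).
pose X (l : nat) := if l == 0%N then A else if l == 1%N then B else
  if (l <= k)%N then C else A.
pose x (l : 'I_n) := X l.
have angle (j : nat) (l : 'I_n) : (pi * (j%:R / (P l)%:R)) *+ P l = pi *+ j :> R.
  rewrite -[LHS]mulr_natr -[RHS]mulr_natr -mulrA divfK // pnatr_eq0.
  by have := P1 l; case: (P l).
have [ltk n_gt0] : (k < n)%N /\ (0 < n)%N by have := ltn_ord k; lia.
apply: (@polygon_not_SU2_simple R n w x c) => //.
- by move=> l; rewrite /x /X; do 3?case: ifP.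
- move=> l; have [->|l0] := eqVneq l i0.
    exists (pi * (j0%:R / (P i0)%:R)), j0; split=> //.
    by rewrite /x /= i0E modn_small //; lia.
  have [->|l1] := eqVneq l i1.
    exists (pi * (j1%:R / (P i1)%:R)), j1; split=> //.
    by rewrite /x /= i1E modn_small /X /= ?k1 //; lia.
  have [->|lk] := eqVneq l k.
    exists (pi * (jk%:R / (P k)%:R)), jk; split=> //.
    have -> : x (ordS k) = A.
      rewrite /x /X; have [-> |[-> _]] := ordS_val k => //.
      by rewrite ltnn eqSS; case: ifP; case: (k : nat) k1 => [|[]].
    suff -> : x k = C by [].
    by rewrite /x /X leqnn; case: (k : nat) k1 => [|[]].
  have /andP[oddl cF] := others l l0 l1 lk.
  exists pi, (P l); split=> //; last by rewrite (negPf cF).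
  rewrite cospi opprK.
  suff -> : x (ordS l) = x l by rewrite /x /X; do 3?case: ifP.
  move: l0 l1 lk; rewrite -!val_eqE /= i0E i1E => /negPf l0 /negPf l1 lk.
  rewrite /x /X l0 l1; have /= [-> |[-> e]] := ordS_val l.
    by rewrite eqSS l0 /=; congr (if _ then _ else _); lia.
  by rewrite /=; case: leqP => //; have := ltn_ord k; lia.
exists i0, i1, k; rewrite /x i0E i1E.
suff -> : X k = C by [].
by rewrite /X leqnn; case: (k : nat) k1 => [|[]].
Qed.

(** Four sides of length 2 pi / 3 are needed to leave the plane: the vertices
    B, A, C, A, A, ... describe two sides through A, each run back and forth. *)
Lemma all_three_not_SU2_simple (n : nat) (w : 'I_n -> seq twist) :
  is_knot (montesinos w) -> (3 < n)%N ->
  (forall i, `|(slope (w i)).2|%N = 3%N) -> ~ SU2_simple R (montesinos w).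
Proof.
move=> knotK n3 P3.
pose a : R := pi / 3.
have a3 : a *+ 3 = pi *+ 1 by rewrite mulr1n /a -[LHS]mulr_natr divfK // pnatr_eq0.
have sa : sin a != 0.
  rewrite gt_eqF // sin_gt0_pi // /a; have := pi_gt0 R.
  by move=> *; apply/andP; split; lra.
pose A : vec R := (1, 0, 0).
pose B : vec R := (- cos a, sin a, 0).
pose C : vec R := (- cos a, 0, sin a).
pose X (l : nat) := if l == 0%N then B else if l == 1%N then A else
  if l == 2%N then C else A.
have ca := cos2Dsin2 a.
have unit_ABC : [/\ dot A A = 1, dot B B = 1 & dot C C = 1].
  by rewrite /dot /=; split; [ring|rewrite -[RHS]ca; ring..].
have [A1 B1 C1] := unit_ABC.
have edges : [/\ dot A B = - cos a, dot B A = - cos a, dot A C = - cos a &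
    dot C A = - cos a] by rewrite /dot /=; split; ring.
have [AB BA AC CA] := edges.
apply: (@polygon_not_SU2_simple R n w (fun l => X l) false) => //.
- by move=> l; rewrite /X; do 3?case: ifP.
- move=> l; have [lt3|ge3] := ltnP l 3.
    exists a, 1%N; rewrite P3; split=> //.
    have /= [-> |[_ e]] := ordS_val l; last by lia.
    by rewrite /X; case: (l : nat) lt3 => [|[|[|]]].
  have XA m : (2 < m)%N -> X m = A by case: m => [|[|[|]]].
  rewrite (XA _ ge3); have /= [-> |[-> e]] := ordS_val l.
    by exists pi, 3%N; rewrite P3 XA ?(leqW ge3) // A1 cospi opprK.
  by exists a, 1%N; rewrite P3.
exists (Ordinal (ltnW (ltnW (ltnW n3)))), (Ordinal (ltnW (ltnW n3))),
  (Ordinal (ltnW n3)).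
rewrite /X /triple /= (_ : _ + _ = - (sin a * sin a)); last by ring.
by rewrite oppr_eq0 mulf_neq0.
Qed.

End Assembly.

Theorem theorem1 (R : realType) (n : nat) (hn : (3 <= n)%N)
    (q p : 'I_n -> int)
    (hp : forall i : 'I_n, 1 < `|p i|)
    (hqp : forall i : 'I_n, coprimez (q i) (p i))
    (w : 'I_n -> seq twist)
    (hw : forall i : 'I_n, has_slope (w i) (q i) (p i))
    (hK : is_knot (montesinos w)) :
  ~ SU2_simple R (montesinos w).
Proof.
pose P i := `|(slope (w i)).2|%N; pose Q i := `|(slope (w i)).1|%N.
have P1 i : (1 < P i)%N := slope_denominator_gt1 (hp i) (hqp i) (hw i).
pose i0 : 'I_n := Ordinal (ltnW (ltnW hn)); pose i1 : 'I_n := Ordinal (ltnW hn).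
pose i2 : 'I_n := Ordinal hn.
have even1 (i j : 'I_n) : i != j -> odd (P i) || odd (P j).
  rewrite -val_eqE neq_ltn => /orP[ij|ji]; last rewrite orbC.
    exact: knot_at_most_one_even hK ij.
  exact: knot_at_most_one_even hK ji.
(* The third tangle is chosen so that an even denominator, or else one
   different from 3, is not missed. *)
have [k [k1 oddP only3]] : exists k : 'I_n, [/\ (1 < k)%N,
    forall l, l != i0 -> l != i1 -> l != k -> odd (P l) &
    P k = 3%N -> forall l : 'I_n, (1 < l)%N -> P l = 3%N].
  have ge2 (l : 'I_n) : l != i0 -> l != i1 -> (1 < l)%N.
    by rewrite -!val_eqE /=; case: (l : nat) => [|[]].
  have [/existsP[k /andP[k1 evk]]|noeven] :=
      boolP [exists k : 'I_n, (1 < k)%N && ~~ odd (P k)].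
    exists k; split=> // [l _ _ lk|Pk3]; last by rewrite Pk3 in evk.
    by have := even1 _ _ lk; rewrite (negPf evk) orbF.
  have oddP (l : 'I_n) : (1 < l)%N -> odd (P l).
    move=> l1; apply: contraNT noeven => evl; apply/existsP.
    by exists l; rewrite l1.
  have [/existsP[k /andP[k1 Pk3]]|all3] :=
      boolP [exists k : 'I_n, (1 < k)%N && (P k != 3%N)].
    by exists k; split=> // [l l0 l1 _|/eqP]; [exact/oddP/ge2|rewrite (negPf Pk3)].
  exists i2; split=> // [l l0 l1 _|_ l l1]; first exact/oddP/ge2.
  by apply/eqP; apply: contraNT all3 => Pl3; apply/existsP; exists l; rewrite l1.
have i01 : i0 != i1 by [].
have [i0k i1k] : i0 != k /\ i1 != k.
  by rewrite -!val_eqE /=; case: (k : nat) k1 => [|[]].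
have [/and3P[/eqP P03 /eqP P13 /eqP Pk3]|not333] :=
    boolP [&& P i0 == 3%N, P i1 == 3%N & P k == 3%N]; last first.
  have [|j0 [j1 [jk [[oj0 oj1 ojk] angles]]]] :=
    odd_anglesP R (P1 i0) (P1 i1) (P1 k) (even1 _ _ i01) (even1 _ _ i0k)
      (even1 _ _ i1k).
    by case=> e0 e1 ek; rewrite e0 e1 ek in not333.
  apply: (@triangle_not_SU2_simple R n w false i0 i1 k j0 j1 jk) => // l l0 l1 lk.
  by rewrite oddP.
have all3 l : P l = 3%N.
  have [->//|l0] := eqVneq l i0; have [->//|l1] := eqVneq l i1.
  by apply: only3 => //; move: l0 l1; rewrite -!val_eqE /=; case: (l : nat) => [|[]].
have [n4|n3] := ltnP 3 n; first exact: all_three_not_SU2_simple.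
have nE : n = 3%N by apply/eqP; rewrite eqn_leq n3.
pose j (i : 'I_n) : nat := if odd (Q i) then 2 else 1.
have oddj i : odd (j i) = ~~ (true && odd (Q i)) by rewrite /j /=; case: (odd (Q i)).
have sumQ : odd (Q i0) (+) odd (Q i1) (+) odd (Q k).
  have : odd (\sum_i Q i)%N.
    by apply: (knot_odd_numerators i0 hK) => i; rewrite -/(P i) all3.
  have -> : k = i2 by apply: val_inj => /=; have := ltn_ord k; lia.
  suff -> : (\sum_i Q i = Q i0 + Q i1 + Q i2)%N by rewrite !oddD.
  rewrite (bigD1 i0) //= (bigD1 i1) //= (bigD1 i2) //= big_pred0 ?addn0 ?addnA //.
  by move=> l; rewrite -!val_eqE /=; have := ltn_ord l; lia.
have angles := angles_333 R sumQ.
apply: (@triangle_not_SU2_simple R n w true i0 i1 k (j i0) (j i1) (j k)) => //.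
- by rewrite -/(P i0) -/(P i1) -/(P k) P03 P13 Pk3.
move=> l; rewrite -!val_eqE /= => l0 l1 lk; exfalso.
by have := ltn_ord l; have := ltn_ord k; lia.
Qed.
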